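(* Let $G$ be a graph on $\nu$ vertices and let $n$ be a positive integer with $\nu\equiv n \pmod 2$, such that $\delta(G)\geq (\nu+n)/2-1$ and $\alpha(G)\leq (\nu-n)/2$. Then $G$ is not $n$-factor-critical if and only if $(\nu-n)/2$ is odd and $G=G_0\vee(G_1\cup G_2)$, where $G_0$ is a graph with $n$ vertices and $G_1=G_2=K_{(\nu-n)/2}$. Moreover, the bounds on $\delta(G)$ and $\alpha(G)$ in the hypotheses are sharp: the conclusion can fail if the hypothesis on $\delta(G)$ is weakened to $\delta(G)\geq (\nu+n)/2-2$, or if the hypothesis on $\alpha(G)$ is weakened to $\alpha(G)\leq (\nu-n)/2+1$.
   Context: All graphs are undirected, simple, finite and connected. $\delta(G)$ is the minimum degree and $\alpha(G)$ the independence number of $G$; $\nu(H)$ is the number of vertices of $H$. A graph $G$ is $n$-factor-critical if $G-S$ has a perfect matching for every $S\subseteq V(G)$ with $|S|=n$. For disjoint graphs $G_1,G_2$, the union $G_1\cup G_2$ has vertex set $V(G_1)\cup V(G_2)$ and edge set $E(G_1)\cup E(G_2)$; the join $G_1\vee G_2$ is obtained from $G_1\cup G_2$ by joining every vertex of $G_1$ to every vertex of $G_2$. $K_m$ is the complete graph on $m$ vertices. *)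

(* Defs.v *)
From mathcomp Require Import all_boot.

Set Implicit Arguments.
Unset Strict Implicit.
Unset Printing Implicit Defensive.

(* Connectedness is a separate predicate, since the pieces of a join need not
   be connected. *)
Record sgraph := SGraph {
  vertex :> finType;
  adj : rel vertex;
  adj_sym : symmetric adj;
  adj_irrefl : irreflexive adj
}.

Definition connected (G : sgraph) : Prop :=
  0 < #|G| /\ forall x y : G, connect (@adj G) x y.

Definition degree (G : sgraph) (x : G) : nat := #|[set y | adj x y]|.

(* Every degree is less than #|G|, so the default value #|G| matters only for
   the graph without vertices. *)
Definition min_degree (G : sgraph) : nat :=
  \big[minn/#|G|]_(x : G) degree x.

Definition independent (G : sgraph) (A : {set G}) : bool :=
  [forall x in A, forall y in A, ~~ adj x y].

Definition independence_number (G : sgraph) : nat :=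
  \max_(A : {set G} | independent A) #|A|.

Definition edges (G : sgraph) : {set {set G}} :=
  [set [set x; y] | x in G, y in [set y | adj x y]].

Definition perfect_matching (G : sgraph) (M : {set {set G}}) : bool :=
  [&& M \subset edges G, trivIset M & cover M == [set: G]].

Section Delete.
Variables (G : sgraph) (S : {set G}).

Definition delete_adj : rel {x : G | x \notin S} :=
  fun x y => adj (val x) (val y).

Lemma delete_adj_sym : symmetric delete_adj.
Proof. by move=> x y; apply: adj_sym. Qed.

Lemma delete_adj_irrefl : irreflexive delete_adj.
Proof. by move=> x; apply: adj_irrefl. Qed.

Definition delete : sgraph := SGraph delete_adj_sym delete_adj_irrefl.
End Delete.

Definition factor_critical (n : nat) (G : sgraph) : Prop :=
  forall S : {set G}, #|S| = n ->
    exists M : {set {set delete S}}, perfect_matching M.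

(* Disjointness of the two vertex sets is built in by taking their sum type. *)
Section UnionJoin.
Variables G1 G2 : sgraph.

Definition union_adj : rel (G1 + G2)%type := fun u v =>
  match u, v with
  | inl x, inl y => adj x y
  | inr x, inr y => adj x y
  | _, _ => false
  end.

Lemma union_adj_sym : symmetric union_adj.
Proof. by move=> [x|x] [y|y] //=; apply: adj_sym. Qed.

Lemma union_adj_irrefl : irreflexive union_adj.
Proof. by move=> [x|x] /=; apply: adj_irrefl. Qed.

Definition graph_union : sgraph := SGraph union_adj_sym union_adj_irrefl.

Definition join_adj : rel (G1 + G2)%type := fun u v =>
  match u, v with
  | inl x, inl y => adj x y
  | inr x, inr y => adj x y
  | _, _ => true
  end.

Lemma join_adj_sym : symmetric join_adj.
Proof. by move=> [x|x] [y|y] //=; apply: adj_sym. Qed.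

Lemma join_adj_irrefl : irreflexive join_adj.
Proof. by move=> [x|x] /=; apply: adj_irrefl. Qed.

Definition graph_join : sgraph := SGraph join_adj_sym join_adj_irrefl.
End UnionJoin.

Section Complete.
Variable m : nat.

Definition complete_adj : rel 'I_m := fun x y => x != y.

Lemma complete_adj_sym : symmetric complete_adj.
Proof. by move=> x y; rewrite /complete_adj eq_sym. Qed.

Lemma complete_adj_irrefl : irreflexive complete_adj.
Proof. by move=> x; rewrite /complete_adj eqxx. Qed.

Definition complete : sgraph := SGraph complete_adj_sym complete_adj_irrefl.
End Complete.

Definition isomorphic (G H : sgraph) : Prop :=
  exists2 f : G -> H, bijective f & forall x y, adj (f x) (f y) = adj x y.

(* An equality "G = ..." between abstract graphs is an isomorphism; G0 is an
   arbitrary, possibly disconnected, graph. *)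
Definition exceptional (n : nat) (G : sgraph) : Prop :=
  let m := (#|G| - n)./2 in
  odd m /\
  exists G0 : sgraph, #|G0| = n /\
    isomorphic G (graph_join G0 (graph_union (complete m) (complete m))).

(* Main.v *)
(* Let S be a set of n vertices such that H = G - S has no perfect matching.
   Then H has 2m = |G| - n vertices, minimum degree at least m - 1 and
   independence number at most m.  Take a maximum matching f of H, viewed as an
   involution, and two exposed vertices u and v.  As there is no augmenting
   path, N(v) and f(N(u)) are disjoint subsets of V(H) \ {u, v}; by the degree
   bound they partition it.  If u and v have a common neighbour, moving along
   alternating paths shows that N(u) = N(v) and that the complement of N(u) is
   an independent set of size m + 1, which is excluded.  Otherwise the closed
   neighbourhoods of u and v partition V(H), there is no edge between them, and
   f pairs up the m - 1 vertices of N(u); so H is twice K_m with m odd, and the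
   degree bound in G joins H completely to S. *)

Require Import Defs.
From mathcomp Require Import all_boot zify.

Set Implicit Arguments.
Unset Strict Implicit.
Unset Printing Implicit Defensive.

(** * Perfect matchings as fixed-point-free involutions *)

Lemma fixfree_involution_even (T : finType) (f : T -> T) (A : {set T}) :
    {in A, forall x, [/\ f x \in A, f x != x & f (f x) = x]} -> ~~ odd #|A|.
Proof.
have [k] := ubnP #|A|; elim: k A => // k IHk A ltAk fA.
have [->|/set0Pn[x Ax]] := eqVneq A set0; first by rewrite cards0.
have [Afx fxx ffx] := fA _ Ax.
have card_A : #|A| = #|A :\ x :\ f x|.+2.
  by rewrite (cardsD1 x) Ax (cardsD1 (f x)) !inE fxx Afx.
rewrite card_A /= negbK; apply: IHk => [|y]; first by lia.
rewrite !inE => /and3P[yfx yx Ay]; have [Afy fyy ffy] := fA _ Ay.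
by split=> //; rewrite Afy andbT; apply/andP; split;
  [apply: contraNneq yx | apply: contraNneq yfx] => e; rewrite -ffy e ?ffx.
Qed.

Section PerfectMatching.
Variable G : sgraph.

Lemma perfect_matching_of_involution (f : G -> G) :
    involutive f -> (forall x, adj x (f x)) ->
  exists M : {set {set G}}, perfect_matching M.
Proof.
move=> fK adj_f; exists [set [set x; f x] | x : G]; apply/and3P; split.
- apply/subsetP => _ /imsetP[x _ ->].
  by apply/imset2P; exists x (f x); rewrite ?inE.
- apply/trivIsetP => _ _ /imsetP[x _ ->] /imsetP[y _ ->].
  apply: contraR => /pred0Pn[z /andP[/set2P zx /set2P zy]]; apply/eqP.
  have pairE w : z = w \/ z = f w -> [set w; f w] = [set z; f z].
    by case=> -> //; rewrite fK setUC.
  by rewrite (pairE x) // (pairE y).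
- rewrite eqEsubset subsetT; apply/subsetP => x _; apply/bigcupP.
  by exists [set x; f x]; rewrite ?inE ?eqxx //; apply/imsetP; exists x.
Qed.

Lemma involution_of_perfect_matching (M : {set {set G}}) :
    perfect_matching M ->
  exists2 f : G -> G, involutive f & forall x, adj x (f x).
Proof.
case/and3P => /subsetP sub_edges trivM /eqP coverM.
have [f fP] : exists f : G -> G, forall x, adj x (f x) && ([set x; f x] \in M).
  have partner x : {y | adj x y && ([set x; y] \in M)}.
    apply: sigW; have : x \in cover M by rewrite coverM inE.
    case/bigcupP => B BM; have /imset2P[a b _] := sub_edges _ BM.
    rewrite inE => ab BE; move: BM; rewrite BE => BM /set2P[]->.
      by exists b; rewrite ab BM.
    by exists a; rewrite adj_sym ab setUC BM.
  by exists (fun x => sval (partner x)) => x; case: (partner x).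
exists f => [x|x]; last by case/andP: (fP x).
have [/andP[adj1 M1] /andP[adj2 M2]] := (fP x, fP (f x)).
(* The matching edges chosen at [x] and at [f x] share the vertex [f x], so disjointness of the
   edges of [M] makes them equal. *)
have eqM : [set x; f x] = [set f x; f (f x)].
  rewrite -(def_pblock trivM M1 (_ : f x \in _)) ?inE ?eqxx ?orbT //.
  by apply: def_pblock; rewrite // !inE eqxx.
have : f (f x) \in [set x; f x] by rewrite eqM !inE eqxx orbT.
by case/set2P=> // e; move: adj2; rewrite e adj_irrefl.
Qed.

End PerfectMatching.

Lemma factor_critical_involution (n : nat) (G : sgraph) (S : {set G}) :
    factor_critical n G -> #|S| = n ->
  exists f : G -> G,
    forall x, x \notin S -> [/\ f x \notin S, adj x (f x) & f (f x) = x].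
Proof.
move=> fc cardS; have [M /involution_of_perfect_matching[h hK adj_h]] := fc S cardS.
(* [insub] fails exactly on [S], where the value [x] is a mere default. *)
exists (fun x => if insub x is Some x' then val (h x') else x) => x xS.
rewrite insubT; split; [exact: (valP (h _)) | exact: (adj_h (Sub x xS)) |].
by rewrite valK hK.
Qed.

(** * Minimum degree, independence number and isomorphism *)

Lemma leq_min_degree (G : sgraph) (x : G) : min_degree G <= degree x.
Proof.
rewrite /min_degree; elim: (index_enum G) (mem_index_enum x) => // y s IHs.
rewrite inE big_cons geq_min => /predU1P[->|/IHs->]; first by rewrite leqnn.
by rewrite orbT.
Qed.

Lemma min_degree_geq (G : sgraph) (k : nat) :
  k <= #|G| -> (forall x : G, k <= degree x) -> k <= min_degree G.
Proof.
move=> kG kdeg; rewrite /min_degree; elim/big_ind: _ => // a b.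
by rewrite leq_min => -> ->.
Qed.

Lemma independent_card (G : sgraph) (A : {set G}) :
  independent A -> #|A| <= independence_number G.
Proof. by move=> indA; exact: (@leq_bigmax_cond _ _ (fun A : {set G} => #|A|) A). Qed.

(** The fibres of [c] are cliques, and an independent set meets a clique at most once, so [c] is
    injective on it. *)
Lemma independence_number_leq_clique_cover (G : sgraph) (T : finType) (c : G -> T) :
    (forall x y, x != y -> c x = c y -> adj x y) ->
  independence_number G <= #|T|.
Proof.
move=> adj_c; apply/bigmax_leqP => A /forallP indA.
rewrite -(card_in_imset (f := c)) ?max_card // => x y xA yA cxy.
apply/eqP; apply: contraT => xy.
by have /implyP/(_ xA)/forallP/(_ y)/implyP/(_ yA)/negP[] := indA x; apply: adj_c.
Qed.

Lemma isomorphic_of_injection (G H : sgraph) (g : H -> G) :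
    injective g -> #|G| <= #|H| -> (forall x y, adj (g x) (g y) = adj x y) ->
  isomorphic G H.
Proof.
move=> inj_g cardGH adj_g; have [f fK gK] := inj_card_bij inj_g cardGH.
by exists f => [|x y]; [exists g | rewrite -adj_g !gK].
Qed.

(** * Maximum matchings and alternating paths *)

Section MaximumMatching.
Variable H : sgraph.
Implicit Types (f : {ffun H -> H}) (u v x y z : H).

(* A matching is encoded as an involution, whose fixed points are the exposed
   vertices. *)
Definition matching f : bool :=
  [forall x, (f (f x) == x) && ((f x != x) ==> adj x (f x))].

Definition exposed f : {set H} := [set x | f x == x].

Definition maximum_matching f : Prop :=
  matching f /\ forall g, matching g -> #|exposed f| <= #|exposed g|.

(* Moves along the alternating path [u - x = f x]. *)
Definition flip f u x : {ffun H -> H} :=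
  [ffun z => if z == u then x else if z == x then u
             else if z == f x then z else f z].

Lemma matchingP f :
  reflect (forall x, f (f x) = x /\ (f x != x -> adj x (f x))) (matching f).
Proof.
apply: (iffP forallP) => mf x; have := mf x.
  by case/andP => /eqP ffx /implyP.
by case=> ffx adjx; rewrite ffx eqxx; apply/implyP.
Qed.

Lemma maximum_matching_exists : exists f, maximum_matching f.
Proof.
(* The identity encodes the empty matching. *)
have id_matching : matching [ffun x => x].
  by apply/matchingP => x; rewrite !ffunE eqxx.
case: (arg_minnP (fun f => #|exposed f|) id_matching) => f mf minf.
by exists f.
Qed.

(** The edge between [x] and [f x] is traded for the edge between [u] and [x]; if [x] is exposed as
    well, that edge is simply added. *)
Lemma flip_matching f u x :
  matching f -> f u = u -> adj u x -> matching (flip f u x).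
Proof.
move=> /matchingP mf fu ux.
have fK y : f (f y) = y by case: (mf y).
have xu : x != u by apply: contraTneq ux => ->; rewrite adj_irrefl.
apply/matchingP => z; rewrite !ffunE.
have [->|zu] := eqVneq z u; first by rewrite eqxx (negPf xu).
have [->|zx] := eqVneq z x; first by rewrite eqxx adj_sym.
have [zfx|zfx] := eqVneq z (f x); first by rewrite (negPf zu) (negPf zx) zfx !eqxx.
have fzu : f z != u by apply: contraNneq zu => e; rewrite -(fK z) e fu.
have fzx : f z != x by apply: contraNneq zfx => e; rewrite -e fK.
have fzfx : f z != f x by apply: contraNneq zx => e; rewrite -(fK z) e fK.
by rewrite (negPf fzu) (negPf fzx) (negPf fzfx); apply: mf.
Qed.

Lemma exposed_flip f u x :
  adj u x -> exposed (flip f u x) \subset f x |: exposed f :\ u.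
Proof.
move=> ux; have xu : x != u by apply: contraTneq ux => ->; rewrite adj_irrefl.
apply/subsetP => z; rewrite !inE ffunE.
have [->|zu] := eqVneq z u; first by rewrite (negPf xu).
have [->|zx] := eqVneq z x; first by rewrite eq_sym (negPf xu).
by have [->|] := eqVneq z (f x).
Qed.

(** Two adjacent exposed vertices could be matched with each other, leaving fewer exposed
    vertices. *)
Lemma exposed_independent f u x :
  maximum_matching f -> f u = u -> adj u x -> f x != x.
Proof.
move=> [mf maxf] fu ux; apply/eqP => fx.
have := maxf _ (flip_matching mf fu ux); rewrite leqNgt => /negP[].
have xu : x != u by apply: contraTneq ux => ->; rewrite adj_irrefl.
have := subset_leq_card (exposed_flip f ux).
rewrite fx cardsU1 !inE xu fx eqxx /= => /leq_ltn_trans-> //.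
by rewrite (cardsD1 u (exposed f)) inE fu eqxx.
Qed.

Lemma flip_maximum f u x :
  maximum_matching f -> f u = u -> adj u x -> maximum_matching (flip f u x).
Proof.
move=> maxf fu ux; have [mf leqf] := maxf.
split=> [|g mg]; first exact: flip_matching.
apply: leq_trans (leqf g mg); apply: leq_trans (subset_leq_card (exposed_flip f ux)) _.
have u_exp : u \in exposed f by rewrite inE fu.
by rewrite cardsU1 (cardsD1 u (exposed f)) u_exp leq_add2r leq_b1.
Qed.

Definition exposed_pair f u v : Prop :=
  [/\ maximum_matching f, u != v, f u = u & f v = v].

Lemma exposed_pair_sym f u v : exposed_pair f u v -> exposed_pair f v u.
Proof. by case=> ? ? ? ?; split; rewrite // eq_sym. Qed.

Section ExposedPair.
Variables (f : {ffun H -> H}) (u v : H).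
Hypothesis Hp : exposed_pair f u v.

Lemma exposed_pairK : involutive f.
Proof. by case: Hp => [[/matchingP mf _] _ _ _] x; case: (mf x). Qed.

Lemma exposed_pair_nonadj : ~~ adj u v.
Proof.
case: Hp => maxf uv fu fv; apply/negP => /(exposed_independent maxf fu).
by rewrite fv eqxx.
Qed.

(** Exposure moves from [u] to [f x] while the matching stays maximum. Facts about exposed pairs
    thus extend to longer alternating paths. *)
Lemma flip_exposed_pair x : adj u x -> exposed_pair (flip f u x) (f x) v.
Proof.
case: (Hp) => maxf uv fu fv ux; have fK := exposed_pairK.
have fxx := exposed_independent maxf fu ux.
have xv : x != v by apply: contraNneq fxx => ->; rewrite fv.
split; first exact: flip_maximum.
- by apply: contraNneq xv => e; rewrite -(fK x) e fv.
- rewrite ffunE (negPf fxx) eqxx; case: eqP => // e.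
  by move: ux; rewrite -(fK x) e fu adj_irrefl.
- by rewrite ffunE eq_sym (negPf uv) eq_sym (negPf xv) fv if_same.
Qed.

Lemma flip_id x z : z != u -> z != x -> z != f x -> flip f u x z = f z.
Proof. by rewrite ffunE => /negPf-> /negPf-> /negPf->. Qed.

End ExposedPair.

(** Otherwise the path [u - x = f x - v] would be augmenting. *)
Lemma exposed_pair_adj f u v x :
  exposed_pair f u v -> adj u x -> ~~ adj v (f x).
Proof.
by move=> Hp /(flip_exposed_pair Hp)/exposed_pair_nonadj; rewrite adj_sym.
Qed.

(** Otherwise the path [u - x = f x - z = f z - v] would be augmenting. *)
Lemma flip_exposed_pair_adj f u v x z :
    exposed_pair f u v -> adj u x -> z != u -> z != x ->
  adj (f x) z -> ~~ adj v (f z).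
Proof.
move=> Hp ux zu zx fxz; have Hp' := flip_exposed_pair Hp ux.
have zfx : z != f x by apply: contraTneq fxz => ->; rewrite adj_irrefl.
by rewrite -(flip_id zu zx zfx); apply: exposed_pair_adj fxz.
Qed.

End MaximumMatching.

(** * Graphs on [2m] vertices with minimum degree at least [m - 1] *)

Section ExtremalStructure.
Variables (H : sgraph) (m : nat).
Implicit Types (f : {ffun H -> H}) (u v x y z : H).
Hypothesis card_H : #|H| = m.*2.
Hypothesis deg_H : forall x : H, m.-1 <= degree x.

Section Tight.
Variables (f : {ffun H -> H}) (u v : H).
Hypothesis Hp : exposed_pair f u v.

Let fK : involutive f := exposed_pairK Hp.

(** The disjoint sets [Nu] and [Nv] have at least [m.-1] elements each and lie among the [m.-1.*2]
    vertices other than [u] and [v], so every inequality is an equality. *)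
Lemma exposed_pair_tight :
  [/\ degree u = m.-1, degree v = m.-1
    & forall z, z != u -> z != v -> adj v z = ~~ adj u (f z)].
Proof.
case: (Hp) => maxf uv fu fv.
pose Nu := [set f x | x in [set y | adj u y]]; pose Nv := [set y | adj v y].
have NuE z : (z \in Nu) = adj u (f z).
  by rewrite -{1}(fK z) mem_imset ?inE //; apply: inv_inj.
have cardNu : #|Nu| = degree u by rewrite card_imset //; apply: inv_inj.
have disj : [disjoint Nu & Nv].
  apply/pred0P => z; rewrite /= NuE inE; apply/negP => /andP[ufz vz].
  by have := exposed_pair_adj Hp ufz; rewrite fK vz.
have sub : Nu :|: Nv \subset ~: [set u; v].
  have nuv := exposed_pair_nonadj Hp.
  apply/subsetP => z; rewrite !inE NuE => /orP[ufz|vz].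
    by apply/norP; split; apply: contraTneq ufz => ->; rewrite ?fu ?fv ?adj_irrefl.
  by apply/norP; split; apply: contraTneq vz => ->; rewrite ?(adj_sym v) ?adj_irrefl.
have cardC : #|~: [set u; v]| = m.-1.*2.
  by rewrite cardsCs setCK cards2 uv card_H; lia.
have cardU : #|Nu :|: Nv| = degree u + degree v.
  by rewrite cardsU (disjoint_setI0 disj) cards0 subn0 cardNu.
have leU := subset_leq_card sub.
have [du dv] := (deg_H u, deg_H v).
split; [lia | lia |] => z zu zv.
have /eqP eqU : Nu :|: Nv == ~: [set u; v] by rewrite eqEcard sub /=; lia.
have : z \in Nu :|: Nv by rewrite eqU !inE negb_or zu.
move/pred0P: disj => /(_ z); rewrite /= !inE NuE.
by case: (adj u _); case: (adj v z).
Qed.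

(** By tightness a third exposed vertex would be adjacent to exactly one of [u] and [v], against
    maximality. *)
Lemma exposed_pair_no_fixed z : z != u -> z != v -> f z != z.
Proof.
case: Hp => maxf uv fu fv zu zv; apply/eqP => fz.
have [_ _ /(_ z zu zv)] := exposed_pair_tight; rewrite fz.
have := @exposed_independent _ f u z maxf fu; have := @exposed_independent _ f v z maxf fv.
by rewrite fz eqxx; case: (adj u z) => [_ /(_ isT)|/(_ _)] //; case: (adj v z) => // /(_ isT).
Qed.

End Tight.

(** If both ends of the matching edge [z = f z] were neighbours of [u], tightness after a flip at
    [x] would make [f x] adjacent to [z], and [v - x = f x - z = f z - u] would be augmenting. *)
Lemma common_neighbor_no_triangle f u v x z :
    exposed_pair f u v -> adj u x -> adj v x -> z != u -> z != v ->
  ~~ (adj u z && adj u (f z)).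
Proof.
move=> Hp ux vx zu zv; apply/negP => /andP[uz ufz].
have [_ uv fu fv] := Hp; have fK := exposed_pairK Hp.
have [_ _ tight] := exposed_pair_tight Hp.
have zx : z != x.
  by apply: contraTneq ufz => ->; have := exposed_pair_adj (exposed_pair_sym Hp) vx.
have zfx : z != f x.
  by apply: contraTneq uz => ->; have := exposed_pair_adj (exposed_pair_sym Hp) vx.
(* Tightness for the exposed pair [f x], [v] of the flipped matching, read at [f z]. *)
have [_ _ /(_ (f z))] := exposed_pair_tight (flip_exposed_pair Hp ux).
have fzfx : f z != f x by apply: contraNneq zx => e; rewrite -(fK z) e fK.
have fzx : f z != x by apply: contraNneq zfx => <-; rewrite fK.
have fzu : f z != u by apply: contraTneq ufz => ->; rewrite adj_irrefl.
have fzv : f z != v by apply: contraNneq zv => e; rewrite -(fK z) e fv.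
rewrite (flip_id fzu fzx fzfx) fK => /(_ fzfx fzv).
rewrite tight // fK uz /= => /esym/negbFE fxz.
have := flip_exposed_pair_adj (exposed_pair_sym Hp) vx zv zx fxz.
by rewrite ufz.
Qed.

Lemma common_neighbor_independent f u v x :
    exposed_pair f u v -> adj u x -> adj v x ->
  m < independence_number H.
Proof.
move=> Hp ux vx; have [_ uv fu fv] := Hp; have fK := exposed_pairK Hp.
have Hp' := exposed_pair_sym Hp.
have [degu _ tight] := exposed_pair_tight Hp.
have nuv := exposed_pair_nonadj Hp.
(* Exactly one end of each matching edge is a neighbour of [u]: both ends are excluded for [u], and
   if neither were, then by tightness both would be neighbours of [v]. *)
have adj_uf z : z != u -> z != v -> adj u (f z) = ~~ adj u z.
  move=> zu zv; have := common_neighbor_no_triangle Hp ux vx zu zv.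
  have := common_neighbor_no_triangle Hp' vx ux zv zu.
  have fzu : f z != u by apply: contraNneq zu => e; rewrite -(fK z) e fu.
  have fzv : f z != v by apply: contraNneq zv => e; rewrite -(fK z) e fv.
  by rewrite !tight // fK; case: (adj u z); case: (adj u (f z)).
have adj_vu z : adj v z = adj u z.
  have [->|zu] := eqVneq z u; first by rewrite adj_sym (negPf nuv) adj_irrefl.
  have [->|zv] := eqVneq z v; first by rewrite (negPf nuv) adj_irrefl.
  by rewrite tight // adj_uf // negbK.
have indep : independent (~: [set y | adj u y]).
  apply/forallP => y; apply/implyP; rewrite !inE => uy.
  apply/forallP => z; apply/implyP; rewrite !inE => uz.
  apply/negP => yz; move: (yz).
  have [yu|yu] := eqVneq y u; first by rewrite yu (negPf uz).
  have [yv|yv] := eqVneq y v; first by rewrite yv adj_vu (negPf uz).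
  have [zu|zu] := eqVneq z u; first by rewrite zu adj_sym (negPf uy).
  have [zv|zv] := eqVneq z v; first by rewrite zv adj_sym adj_vu (negPf uy).
  (* Adjacent non-neighbours [y] and [z] of [u] would make [u - f y = y - z = f z - v]
     augmenting. *)
  have ufy : adj u (f y) by rewrite adj_uf.
  have zfy : z != f y by apply: contraNneq uz => ->.
  move=> _; have := @flip_exposed_pair_adj _ f u v (f y) z Hp ufy zu zfy.
  by rewrite fK adj_vu adj_uf // uz => /(_ yz).
apply: leq_trans (independent_card indep).
(* Since [m.-1] is truncated, the count [m.*2 - m.-1 = m.+1] requires a positive [m]. *)
have m_gt0 : 0 < m by have := max_card [set u; v]; rewrite cards2 uv card_H; lia.
rewrite cardsCs setCK card_H -[#|[set _ | _]|]/(degree u) degu; lia.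
Qed.

Definition two_cliques (A B : {set H}) : Prop :=
  [/\ #|A| = m, B = ~: A,
      {in A & B, forall x y, ~~ adj x y},
      {in A &, forall x y, x != y -> adj x y}
    & {in B &, forall x y, x != y -> adj x y}].

(** All neighbours of a vertex lie in its own part, which offers only [m.-1] candidates; the degree
    bound then takes them all. *)
Lemma separated_cliques (A B : {set H}) :
    #|A| = m -> B = ~: A -> {in A & B, forall x y, ~~ adj x y} ->
  two_cliques A B.
Proof.
move=> cardA BE sepAB.
have cardB : #|B| = m by rewrite BE cardsCs setCK cardA card_H; lia.
have clique (C : {set H}) : #|C| = m ->
    {in C & ~: C, forall x y, ~~ adj x y} ->
    {in C &, forall x y, x != y -> adj x y}.
  move=> cardC sepC x y xC yC xy; suff : y \in [set z | adj x z] by rewrite inE.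
  suff -> : [set z | adj x z] = C :\ x by rewrite !inE eq_sym xy.
  apply/eqP; rewrite eqEcard; apply/andP; split.
    apply/subsetP => z; rewrite !inE => xz; apply/andP; split.
      by apply: contraTneq xz => ->; rewrite adj_irrefl.
    by apply: contraTT xz => zC; apply: sepC; rewrite ?inE.
  by apply: leq_trans (deg_H x); have := cardsD1 x C; rewrite xC cardC; lia.
split=> //; apply: clique => //; first by rewrite -BE.
by rewrite BE setCK => x y xB yA; rewrite adj_sym; apply: sepAB; rewrite ?BE.
Qed.

Lemma no_common_neighbor_cliques f u v :
    exposed_pair f u v -> (forall x, ~~ (adj u x && adj v x)) ->
  odd m /\ exists A B, two_cliques A B.
Proof.
move=> Hp nocommon; have [_ uv fu fv] := Hp; have fK := exposed_pairK Hp.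
have [degu degv tight] := exposed_pair_tight Hp.
have nuv := exposed_pair_nonadj Hp.
pose Nu := [set y | adj u y].
have uNu : u \notin Nu by rewrite inE adj_irrefl.
(* By tightness, [nocommon] at [z] and at [f z] says that either both or neither of them are
   neighbours of [u]. *)
have adj_vu z : z != u -> z != v -> adj v z = ~~ adj u z.
  move=> zu zv; have := nocommon z; have := nocommon (f z).
  have fzu : f z != u by apply: contraNneq zu => e; rewrite -(fK z) e fu.
  have fzv : f z != v by apply: contraNneq zv => e; rewrite -(fK z) e fv.
  by rewrite !tight // fK; case: (adj u z); case: (adj u (f z)).
have NuP z : z \in Nu -> [/\ z != u, z != v & f z \in Nu].
  rewrite !inE => uz; have zu : z != u by apply: contraTneq uz => ->; rewrite adj_irrefl.
  have zv : z != v by apply: contraTneq uz => ->.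
  by split=> //; apply: negbNE; rewrite -tight // adj_vu // uz.
have m_gt0 : 0 < m by have := max_card [set u; v]; rewrite cards2 uv card_H; lia.
split.
  suff : ~~ odd #|Nu| by rewrite -[#|Nu|]/(degree u) degu; lia.
  apply: (fixfree_involution_even (f := f)) => z zNu.
  have [zu zv fzNu] := NuP z zNu.
  by split; rewrite ?(exposed_pair_no_fixed Hp) ?fK.
exists (u |: Nu), (~: (u |: Nu)); apply: separated_cliques => //.
  by rewrite cardsU1 uNu -[#|Nu|]/(degree u) degu; lia.
move=> a c; rewrite in_setU1 => aA; rewrite !inE negb_or => /andP[cu uc].
have [->//|au] := eqVneq a u; move: aA; rewrite (negPf au) /= => aNu.
have [_ av faNu] := NuP a aNu.
have [->|cv] := eqVneq c v.
  by have := nocommon a; rewrite (adj_sym a); move: aNu; rewrite inE => ->.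
apply/negP => ac; rewrite !inE in aNu faNu.
have cfa : c != f a by apply: contraNneq uc => ->.
(* An edge from [a] to [c] would make [u - f a = a - c = f c - v] augmenting. *)
have := @flip_exposed_pair_adj _ f u v (f a) c Hp faNu cu cfa.
rewrite fK => /(_ ac); rewrite tight ?fK ?uc //.
  by apply: contraNneq cu => e; rewrite -(fK c) e fu.
by apply: contraNneq cv => e; rewrite -(fK c) e fv.
Qed.

Lemma perfect_matching_or_two_cliques :
    independence_number H <= m ->
  (exists M : {set {set H}}, perfect_matching M) \/
  (odd m /\ exists A B, two_cliques A B).
Proof.
move=> alpha_m; have [f maxf] := maximum_matching_exists H.
have /matchingP mf := maxf.1.
have fK : involutive f by move=> x; case: (mf x).
have [exp0|/set0Pn[u u_exp]] := eqVneq (exposed f) set0.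
  left; apply: (perfect_matching_of_involution fK) => x; apply: (mf x).2.
  by move/setP/(_ x): exp0; rewrite !inE => ->.
(* The matched vertices come in pairs and [H] has even order, so [u] cannot be the only exposed
   vertex. *)
have even_exp : ~~ odd #|exposed f|.
  have : ~~ odd #|~: exposed f|.
    apply: (fixfree_involution_even (f := f)) => x; rewrite !inE => fx.
    by rewrite fK eq_sym.
  by rewrite cardsCs setCK card_H; have := max_card (exposed f); rewrite card_H; lia.
have /set0Pn[v] : exposed f :\ u != set0.
  by rewrite -card_gt0; move: even_exp; rewrite (cardsD1 u) u_exp; case: #|_|.
rewrite !inE in u_exp *; case/andP => vu /eqP fv.
have Hp : exposed_pair f u v by split; rewrite // 1?eq_sym //; apply/eqP.
right; apply: (no_common_neighbor_cliques Hp) => x; apply/negP => /andP[ux vx].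
by have := common_neighbor_independent Hp ux vx; rewrite ltnNge alpha_m.
Qed.

End ExtremalStructure.

(** * The exceptional graphs and the characterization *)

(** Deleting the copy [S] of [G0] leaves two components of odd order [m]; a perfect matching would
    pair up the vertices of the component [A]. *)
Lemma exceptional_not_factor_critical (n : nat) (G : sgraph) :
  exceptional n G -> ~ factor_critical n G.
Proof.
set m := (#|G| - n)./2; case=> odd_m [G0 [cardG0 [h [k hK kK] adj_h]]].
pose S : {set G} := [set x | if h x is inl _ then true else false].
have cardS : #|S| = n.
  rewrite -cardG0 -cardsT -(card_imset setT (inj_comp (can_inj kK) (@inl_inj G0 _))).
  apply: eq_card => x; apply/idP/imsetP => [|[a _ ->]]; rewrite inE /= ?kK //.
  by case hx: (h x) => [a|//] _; exists a; rewrite //= -hx hK.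
move=> fc; have [f fP] := factor_critical_involution fc cardS.
pose A : {set G} := [set x | if h x is inr (inl _) then true else false].
have cardA : #|A| = m.
  rewrite -[RHS]card_ord -cardsT.
  rewrite -(card_imset setT (inj_comp (can_inj kK) (inj_comp (@inr_inj G0 _) (@inl_inj _ _)))).
  apply: eq_card => x; apply/idP/imsetP => [|[a _ ->]]; rewrite inE /= ?kK //.
  by case hx: (h x) => [//|[a|//]] _; exists a; rewrite //= -hx hK.
have : ~~ odd #|A|.
  apply: (fixfree_involution_even (f := f)) => x; rewrite inE.
  case hx: (h x) => [//|[a|//]] _.
  have [|fxS adjx ffx] := fP x; first by rewrite inE hx.
  split=> //; last by apply: contraTneq adjx => ->; rewrite adj_irrefl.
  by move: fxS adjx; rewrite -adj_h hx !inE; case: (h (f x)) => [|[]].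
by rewrite cardA odd_m.
Qed.

Section Delete.
Variables (G : sgraph) (S : {set G}).

Lemma card_delete : #|delete S| = #|G| - #|S|.
Proof.
by rewrite card_sub -[S in RHS]setCK -cardsCs; apply: eq_card => x; rewrite !inE.
Qed.

Lemma degree_delete (x : delete S) :
  degree (val x) <= degree x + #|S :&: [set y | adj (val x) y]|.
Proof.
rewrite /degree -(card_imset _ (@val_inj _ _ (delete S))).
apply: leq_trans (leq_card_setU _ _); apply: subset_leq_card.
apply/subsetP => y; rewrite !inE => xy; have [yS|yS] := boolP (y \in S).
  by rewrite xy orbT.
by rewrite orbF; apply/imsetP; exists (Sub y yS); rewrite ?inE.
Qed.

Lemma independence_number_delete :
  independence_number (delete S) <= independence_number G.
Proof.
apply/bigmax_leqP => A indA; rewrite -(card_imset _ (@val_inj _ _ (delete S))).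
apply: independent_card; apply/forall_inP => _ /imsetP[x xA ->].
by apply/forall_inP => _ /imsetP[y yA ->]; move/forall_inP/(_ x xA)/forall_inP: indA; apply.
Qed.
End Delete.

(** All quantifiers range over finite types, so the failing set is found by boolean reflection,
    without excluded middle. *)
Lemma not_factor_critical_delete (n : nat) (G : sgraph) :
    ~ factor_critical n G ->
  exists2 S : {set G}, #|S| = n & ~ exists M : {set {set delete S}}, perfect_matching M.
Proof.
move=> nfc; have : ~~ [forall S : {set G}, (#|S| == n) ==>
    [exists M : {set {set delete S}}, perfect_matching M]].
  apply/negP => /forallP fc; apply: nfc => S /eqP cardS.
  by move: (fc S); rewrite cardS => /existsP.
case/forallPn => S; rewrite negb_imply => /andP[/eqP cardS /existsP noM].
by exists S.
Qed.

Lemma exceptional_of_cliques (n m : nat) (G : sgraph) (S A B : {set G}) :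
    odd m -> #|S| = n -> #|A| = m -> B = ~: (S :|: A) -> [disjoint S & A] ->
    #|G| = n + m.*2 ->
    {in S & ~: S, forall x y, adj x y} ->
    {in A & B, forall x y, ~~ adj x y} ->
    {in A &, forall x y, x != y -> adj x y} ->
    {in B &, forall x y, x != y -> adj x y} ->
  exceptional n G.
Proof.
move=> odd_m cardS cardA BE disjSA cardG adjS sepAB adjA adjB; rewrite /exceptional.
have -> : (#|G| - n)./2 = m by rewrite cardG; lia.
split=> //.
have cardB : #|B| = m.
  rewrite BE cardsCs setCK cardsU (disjoint_setI0 disjSA) cards0.
  by rewrite cardG cardS cardA; lia.
pose a (i : complete m) : G := enum_val (cast_ord (esym cardA) i).
pose b (i : complete m) : G := enum_val (cast_ord (esym cardB) i).
have aA i : a i \in A by apply: enum_valP.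
have bB i : b i \in B by apply: enum_valP.
have aS i : a i \notin S by rewrite (disjointFl disjSA (aA i)).
have bS i : b i \notin S by have := bB i; rewrite BE !inE => /norP[].
have bA i : b i \notin A by have := bB i; rewrite BE !inE => /norP[].
have a_inj : injective a by move=> i j /enum_val_inj/cast_ord_inj.
have b_inj : injective b by move=> i j /enum_val_inj/cast_ord_inj.
(* The subgraph induced on [S], obtained by deleting the complement. *)
pose G0 := delete (~: S).
have valS (x : G0) : val x \in S by have := valP x; rewrite inE negbK.
have cardG0 : #|G0| = n.
  by rewrite card_delete -cardS cardsCs setCK; have := max_card S; lia.
exists G0; split=> //.
pose g (x : graph_join G0 (graph_union (complete m) (complete m))) : G :=
  match x with inl s => val s | inr (inl i) => a i | inr (inr i) => b i end.
apply: (@isomorphic_of_injection _ _ g).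
- have neqS s y : y \notin S -> val (s : G0) <> y by move=> yS e; rewrite -e valS in yS.
  have neqab i j : a i <> b j by move=> e; have := aA i; rewrite e (negPf (bA j)).
  move=> [s|[i|i]] [t|[j|j]] //=.
  + by move/val_inj->.
  + by move/neqS => /(_ (aS j)).
  + by move/neqS => /(_ (bS j)).
  + by move/esym/neqS => /(_ (aS i)).
  + by move/a_inj->.
  + by move/neqab.
  + by move/esym/neqS => /(_ (bS i)).
  + by move/esym/neqab.
  + by move/b_inj->.
- by rewrite !card_sum cardG0 !card_ord cardG -addnn.
- have adjSx s y : y \notin S -> adj (val (s : G0)) y.
    by move=> yS; apply: adjS; rewrite ?inE.
  move=> [s|[i|i]] [t|[j|j]] //=; rewrite ?adjSx // 1?adj_sym ?adjSx //.
  + rewrite /complete_adj; have [->|ij] := eqVneq i j; first by rewrite adj_irrefl.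
    by rewrite adjA // (inj_eq a_inj) eq_sym.
  + by rewrite adj_sym; apply/negbTE/sepAB.
  + by apply/negbTE/sepAB.
  + rewrite /complete_adj; have [->|ij] := eqVneq i j; first by rewrite adj_irrefl.
    by rewrite adjB // (inj_eq b_inj) eq_sym.
Qed.

Lemma factor_critical_or_exceptional (n : nat) (G : sgraph) :
    #|G| = n %[mod 2] -> (#|G| + n)./2 - 1 <= min_degree G ->
    independence_number G <= (#|G| - n)./2 ->
  ~ factor_critical n G -> exceptional n G.
Proof.
move=> parG degG alphaG /not_factor_critical_delete[S cardS noM].
have degGx x := leq_trans degG (leq_min_degree x).
set m := (#|G| - n)./2 in alphaG.
have leSG : n <= #|G| by rewrite -cardS max_card.
have cardG : #|G| = n + m.*2 by rewrite /m; lia.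
have cardH : #|delete S| = m.*2 by rewrite card_delete cardS cardG; lia.
(* Here [(#|G| + n)./2 = n + m], and deleting [S] costs a vertex at most [n] neighbours. *)
have degH (x : delete S) : m.-1 <= degree x.
  have := degree_delete x; have := degGx (val x).
  by have := subset_leq_card (subsetIl S [set y | adj (val x) y]); rewrite cardS cardG; lia.
have alphaH := leq_trans (independence_number_delete S) alphaG.
have [/noM//|[odd_m [A [B [cardA BE sepAB adjA adjB]]]]] :=
  perfect_matching_or_two_cliques cardH degH alphaH.
have cardB : #|B| = m by rewrite BE cardsCs setCK cardA cardH; lia.
have mem_val (C : {set delete S}) (x : delete S) : (val x \in val @: C) = (x \in C).
  by rewrite mem_imset //; apply: val_inj.
(* Inside its clique [y] has at most [m - 1] neighbours, so reaching degree [n + m - 1] takes all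
   [n] vertices of [S]. *)
have adj_S x y : x \in S -> y \in ~: S -> adj x y.
  rewrite inE => xS yS; pose y' : delete S := Sub y yS; apply: contraT => nxy.
  have degy' : degree y' < m.
    have clique (C : {set delete S}) : #|C| = m -> y' \in C ->
        {in C & ~: C, forall z t, ~~ adj z t} -> degree y' < m.
      move=> cardC y'C sepC; rewrite -cardC (cardsD1 y' C) y'C add1n ltnS.
      apply/subset_leq_card/subsetP => z; rewrite !inE => yz; apply/andP; split.
        by apply: contraTneq yz => ->; rewrite adj_irrefl.
      by apply: contraTT yz => zC; apply: sepC; rewrite ?inE.
    have [y'A|y'A] := boolP (y' \in A); first by apply: (clique A); rewrite -?BE.
    apply: (clique B); rewrite // BE ?inE // setCK -BE => z t zB tA.
    by rewrite adj_sym sepAB.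
  have cardSy : #|S :&: [set z | adj y z]| < n.
    rewrite -cardS; apply: proper_card; rewrite properE subsetIl /=.
    by apply/subsetPn; exists x; rewrite // !inE xS adj_sym.
  by have := degree_delete y'; have := degGx y; rewrite /= cardG; lia.
apply: (@exceptional_of_cliques n m G S (val @: A) (val @: B)) => //.
- by rewrite card_imset //; apply: val_inj.
- apply/setP => x; rewrite !inE; have [xS|xS] := boolP (x \in S).
    by apply/imsetP => -[y _ xy]; rewrite xy (negPf (valP y)) in xS.
  by rewrite -[x]/(val (Sub x xS : delete S)) !mem_val BE inE.
- apply/pred0P => x /=; apply/negP => /andP[xS /imsetP[y _ xy]].
  by rewrite xy (negPf (valP y)) in xS.
- by move=> _ _ /imsetP[x xA ->] /imsetP[y yB ->]; apply: sepAB.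
- by move=> _ _ /imsetP[x xA ->] /imsetP[y yA ->]; rewrite (inj_eq val_inj); apply: adjA.
- by move=> _ _ /imsetP[x xB ->] /imsetP[y yB ->]; rewrite (inj_eq val_inj); apply: adjB.
Qed.

(** * Sharpness of the two bounds *)

Section SharpnessExamples.
Variable n : nat.

(* For both graphs [(#|G| - n)./2 = 2] is even, so they are not exceptional. *)
Lemma not_exceptional_card (G : sgraph) : #|G| = n + 4 -> ~ exceptional n G.
Proof. by move=> cardG [+ _]; rewrite cardG addKn. Qed.

Lemma universal_connected (G : sgraph) (x : G) :
  (forall y, y != x -> adj x y) -> connected G.
Proof.
move=> adjx; split=> [|y z]; first by apply/card_gt0P; exists x.
have cx y' : connect (@adj G) x y' /\ connect (@adj G) y' x.
  have [->|/adjx xy] := eqVneq y' x; first by rewrite connect0.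
  by split; apply: connect1; rewrite // adj_sym.
exact: connect_trans (cx y).2 (cx z).1.
Qed.

Let core : {set 'I_(n + 4)} := [set x : 'I_(n + 4) | x < n].

Lemma card_initial (k : nat) : k <= 4 -> #|[set x : 'I_(n + 4) | x < n + k]| = n + k.
Proof.
move=> k4; have le : n + k <= n + 4 by rewrite leq_add2l.
rewrite -[RHS]card_ord -cardsT -(card_imset setT (f := widen_ord le)).
  apply: eq_card => x; rewrite inE; apply/idP/imsetP => [xk|[y _ ->]]; last exact: (ltn_ord y).
  by exists (Ordinal xk) => //; apply: val_inj.
by move=> x y /(congr1 val) /= /val_inj.
Qed.

(* [K_n] joined to [K_1 + K_3]; the vertex [K_1] is [n]. *)
Definition degree_example_adj : rel 'I_(n + 4) :=
  fun x y => (x != y) && [|| x < n, y < n | (n < x) && (n < y)].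

Lemma degree_example_sym : symmetric degree_example_adj.
Proof.
by move=> x y; rewrite /degree_example_adj eq_sym orbCA [(n < x) && _]andbC.
Qed.

Lemma degree_example_irrefl : irreflexive degree_example_adj.
Proof. by move=> x; rewrite /degree_example_adj eqxx. Qed.

Definition degree_example : sgraph := SGraph degree_example_sym degree_example_irrefl.

(* [K_(n+1)] joined to three isolated vertices. *)
Definition alpha_example_adj : rel 'I_(n + 4) :=
  fun x y => (x != y) && ((x <= n) || (y <= n)).

Lemma alpha_example_sym : symmetric alpha_example_adj.
Proof. by move=> x y; rewrite /alpha_example_adj eq_sym orbC. Qed.

Lemma alpha_example_irrefl : irreflexive alpha_example_adj.
Proof. by move=> x; rewrite /alpha_example_adj eqxx. Qed.

Definition alpha_example : sgraph := SGraph alpha_example_sym alpha_example_irrefl.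

Lemma degree_example_connected : 0 < n -> connected degree_example.
Proof.
move=> n_gt0; have lt0 : 0 < n + 4 by rewrite addn_gt0 n_gt0.
apply: (@universal_connected degree_example (Ordinal lt0)) => y y0.
by rewrite /= /degree_example_adj eq_sym y0 /= n_gt0.
Qed.

Lemma alpha_example_connected : connected alpha_example.
Proof.
have lt0 : 0 < n + 4 by rewrite addn4.
apply: (@universal_connected alpha_example (Ordinal lt0)) => y y0.
by rewrite /= /alpha_example_adj eq_sym y0.
Qed.

(** With [n + 4] vertices, [n] is exactly the weakened bound [(#|G| + n)./2 - 2]. *)
Lemma degree_example_min_degree : n <= min_degree degree_example.
Proof.
apply: min_degree_geq => [|x]; first by rewrite card_ord leq_addr.
have [xn|xn] := ltnP x n.
  apply: (@leq_trans #|[set~ x]|); first by rewrite cardsC1 card_ord; lia.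
  apply/subset_leq_card/subsetP => y; rewrite !inE /= /degree_example_adj xn.
  by rewrite eq_sym => ->.
rewrite -{1}(addn0 n) -(card_initial (leq0n 4)) addn0.
apply/subset_leq_card/subsetP => y; rewrite !inE /= /degree_example_adj => yn.
by rewrite yn orbT andbT neq_ltn (leq_trans yn xn) orbT.
Qed.

Lemma alpha_example_min_degree : n + 1 <= min_degree alpha_example.
Proof.
apply: min_degree_geq => [|x]; first by rewrite card_ord leq_add2l.
have [xn|xn] := leqP x n.
  apply: (@leq_trans #|[set~ x]|); first by rewrite cardsC1 card_ord; lia.
  apply/subset_leq_card/subsetP => y; rewrite !inE /= /alpha_example_adj xn.
  by rewrite eq_sym => ->.
rewrite -(@card_initial 1) //.
apply/subset_leq_card/subsetP => y; rewrite !inE /= /alpha_example_adj addn1 ltnS => yn.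
by rewrite yn orbT andbT neq_ltn (leq_ltn_trans yn xn) orbT.
Qed.

(** The vertex [n] alone and all the other vertices together form two cliques. *)
Lemma degree_example_independence : independence_number degree_example <= 2.
Proof.
rewrite -card_bool.
apply: (@independence_number_leq_clique_cover degree_example _ (fun x => val x == n)).
move=> x y xy; rewrite /= /degree_example_adj xy /=.
by move: xy; rewrite -val_eqE /=; lia.
Qed.

Lemma alpha_example_independence : independence_number alpha_example <= 3.
Proof.
rewrite -(card_ord 3).
(* Truncated subtraction sends [0] up to [n.+1] to [0]: these are the universal vertices and one of
   the three others, a clique. The last two vertices form singleton classes. *)
apply: (@independence_number_leq_clique_cover alpha_example _ (fun x => inord (val x - n.+1))).
move=> x y xy /(congr1 val); have := ltn_ord x; have := ltn_ord y.
move: xy; rewrite /= /alpha_example_adj -val_eqE /= => xy ltx lty.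
by rewrite !inordK; lia.
Qed.

Lemma card_core : #|core| = n.
Proof. by rewrite -[RHS]addn0 -(card_initial (leq0n 4)) addn0. Qed.

(** Deleting [core] isolates the vertex [n]. *)
Lemma degree_example_not_factor_critical : ~ factor_critical n degree_example.
Proof.
move=> fc; have [f fP] := @factor_critical_involution n degree_example core fc card_core.
have ltn4 : n < n + 4 by lia.
have [] := fP (Ordinal ltn4); first by rewrite inE /= ltnn.
by rewrite inE /= /degree_example_adj /= ltnn => /negPf->; rewrite andbF.
Qed.

(** Deleting [core] leaves a star with centre [n] and three leaves; two leaves would both have to be
    matched with [n]. *)
Lemma alpha_example_not_factor_critical : ~ factor_critical n alpha_example.
Proof.
move=> fc; have [f fP] := @factor_critical_involution n alpha_example core fc card_core.
have center k (lt_k : n + k < n + 4) : 0 < k ->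
    val (f (Ordinal lt_k)) = n /\ f (f (Ordinal lt_k)) = Ordinal lt_k.
  move=> k_gt0; have [] := fP (Ordinal lt_k); first by rewrite inE /=; lia.
  by rewrite inE /= /alpha_example_adj /= => h1 /andP[_ h2] h3; split=> //; lia.
have lt1 : n + 1 < n + 4 by lia.
have lt2 : n + 2 < n + 4 by lia.
have [e1 f1] := center _ lt1 isT; have [e2 f2] := center _ lt2 isT.
have e : f (Ordinal lt1) = f (Ordinal lt2) by apply: val_inj; rewrite /= e1 e2.
by have := congr1 val f1; rewrite e f2 /=; lia.
Qed.

End SharpnessExamples.

Theorem theorem9 (n : nat) (n_gt0 : 0 < n) :
  (forall G : sgraph,
     connected G ->
     #|G| = n %[mod 2] ->
     (#|G| + n)./2 - 1 <= min_degree G ->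
     independence_number G <= (#|G| - n)./2 ->
     (~ factor_critical n G <-> exceptional n G)) /\
  (exists G : sgraph,
     connected G /\
     #|G| = n %[mod 2] /\
     (#|G| + n)./2 - 2 <= min_degree G /\
     independence_number G <= (#|G| - n)./2 /\
     ~ (~ factor_critical n G <-> exceptional n G)) /\
  (exists G : sgraph,
     connected G /\
     #|G| = n %[mod 2] /\
     (#|G| + n)./2 - 1 <= min_degree G /\
     independence_number G <= (#|G| - n)./2 + 1 /\
     ~ (~ factor_critical n G <-> exceptional n G)).
Proof.
split; [move=> G conG parG degG alphaG; split |
  split; [exists (degree_example n) | exists (alpha_example n)]].
- exact: factor_critical_or_exceptional parG degG alphaG.
- exact: exceptional_not_factor_critical.
- have cardE : #|degree_example n| = n + 4 by rewrite card_ord.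
  split; first exact: degree_example_connected.
  rewrite cardE addKn; do !split => //; first by lia.
  + by apply: leq_trans (degree_example_min_degree n); lia.
  + exact: degree_example_independence.
  + case=> /(_ (@degree_example_not_factor_critical n)) exc _.
    exact: not_exceptional_card exc.
- have cardE : #|alpha_example n| = n + 4 by rewrite card_ord.
  split; first exact: alpha_example_connected.
  rewrite cardE addKn; do !split => //; first by lia.
  + by apply: leq_trans (alpha_example_min_degree n); lia.
  + exact: alpha_example_independence.
  + case=> /(_ (@alpha_example_not_factor_critical n)) exc _.
    exact: not_exceptional_card exc.
Qed.
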